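(* Suppose $g$ is strictly convex and an equilibrium $\hat{\mathbf p}$ exists. Then there exists a pure equilibrium equivalent to $\hat{\mathbf p}$, and such a pure equilibrium is obtained by changing each $\hat p_x\in(0,1)$ (if there are any) to $1$; that is, the vector $\tilde{\mathbf p}$ with $\tilde p_x=1$ if $\hat p_x\in(0,1)$ and $\tilde p_x=\hat p_x$ otherwise is an equilibrium with $J_{\tilde{\mathbf p}}(x)=J_{\hat{\mathbf p}}(x)$ for all $x\in E$.
   Context: Setting: $E$ is a finite set with $N$ elements and $X=(X_n)_{n\in\mathbb N_0}$ is a time-homogeneous Markov chain on $E$; under $\mathbb P_x$ (expectation $\mathbb E_x$) one has $X_0=x$ a.s. The chain is absorbing: from every $x\in E$ some absorbing state is reached with positive probability in finitely many steps. $(Y_n)_{n\in\mathbb N_0}$ are i.i.d. uniform on $[0,1]$ and independent of $X$. $f,h:E\to\mathbb R$ are functions and $g:\mathbb R\to\mathbb R$ is continuous. Vectors in $\mathbb R^N$ are identified with functions on $E$: $\mathbf p=(p_x)_{x\in E}$. A (mixed) stopping strategy is a vector $\mathbf p\in[0,1]^N$; it is pure if $\mathbf p\in\{0,1\}^N$. Its stopping time is $\tau_{\mathbf p}=\min\{n\ge0: Y_n\le p_{X_n}\}$ ($=\infty$ if there is no such $n$). Convention: on $\{\tau=\infty\}$, $f(X_\tau):=\lim_{n\to\infty}f(X_n)$ and $h(X_\tau):=\lim_{n\to\infty}h(X_n)$ (the limits exist a.s. because $X$ is absorbing). Notation: $\phi_{\mathbf p}(x)=\mathbb E_x(f(X_{\tau_{\mathbf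 p}}))$, $\psi_{\mathbf p}(x)=\mathbb E_x(h(X_{\tau_{\mathbf p}}))$, $J_{\mathbf p}(x)=\phi_{\mathbf p}(x)+g(\psi_{\mathbf p}(x))$. A stopping strategy $\hat{\mathbf p}$ is an equilibrium if for all $q\in[0,1]$ and all $x\in E$, $$J_{\hat{\mathbf p}}(x)\ge q f(x)+(1-q)\mathbb E_x(\phi_{\hat{\mathbf p}}(X_1))+g\big(q h(x)+(1-q)\mathbb E_x(\psi_{\hat{\mathbf p}}(X_1))\big).$$ The equilibrium is pure if $\hat{\mathbf p}$ is pure. Two equilibria $\mathbf p,\hat{\mathbf p}$ are equivalent if $J_{\mathbf p}(x)=J_{\hat{\mathbf p}}(x)$ for each $x\in E$. *)

(* Defs.v *)
From HB Require Import structures.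
From mathcomp Require Import all_boot all_order all_algebra.
From mathcomp Require Import all_classical all_reals all_analysis.
Import Order.TTheory GRing.Theory Num.Theory.
Import numFieldNormedType.Exports.

Set Implicit Arguments.
Unset Strict Implicit.
Unset Printing Implicit Defensive.

Local Open Scope classical_set_scope.
Local Open Scope ring_scope.

Definition strictly_convex (R : realType) (g : R -> R) : Prop :=
  forall (x y t : R), x != y -> 0 < t < 1 ->
    g (t * x + (1 - t) * y) < t * g x + (1 - t) * g y.

Definition stochastic (R : realType) (E : finType) (Q : E -> E -> R) : Prop :=
  (forall x y, 0 <= Q x y) /\ (forall x, \sum_y Q x y = 1).

Definition path_event (T : Type) (E : finType) (X : nat -> T -> E)
    (n : nat) (e : nat -> E) : set T :=
  [set w | forall i, (i <= n)%N -> X i w = e i].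

(* The Markov property is written multiplicatively, so that conditioning on
   a null event imposes nothing. *)
Definition markov_chain (R : realType) (d : measure_display)
    (T : measurableType d) (E : finType) (P : E -> probability T R)
    (X : nat -> T -> E) (Q : E -> E -> R) : Prop :=
  [/\ forall n x, measurable (X n @^-1` [set x]),
      stochastic Q,
      forall x, P x (X 0%N @^-1` [set x]) = 1%E
    & forall x n (e : nat -> E),
        P x (path_event X n.+1 e)
        = (P x (path_event X n e) * (Q (e n) (e n.+1))%:E)%E].

Definition absorbing_state (R : realType) (E : finType) (Q : E -> E -> R)
    (a : E) : Prop :=
  Q a a = 1.

Definition absorbing_chain (R : realType) (d : measure_display)
    (T : measurableType d) (E : finType) (P : E -> probability T R)
    (X : nat -> T -> E) (Q : E -> E -> R) : Prop :=
  forall x, exists a n,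
    absorbing_state Q a /\ (0 < P x (X n @^-1` [set a]))%E.

Definition iid_uniform01 (R : realType) (d : measure_display)
    (T : measurableType d) (P : probability T R)
    (Y : nat -> {mfun T >-> measurableTypeR R}) : Prop :=
  (forall n (B : set (measurableTypeR R)), measurable B ->
     P (Y n @^-1` B) = uniform_prob (@ltr01 R) B) /\
  (forall (s : seq nat) (B : nat -> set (measurableTypeR R)),
     uniq s -> (forall i, measurable (B i)) ->
     P (\big[setI/setT]_(i <- s) (Y i @^-1` B i))
     = (\prod_(i <- s) P (Y i @^-1` B i))%E).

Definition sigma_of_chain (T : Type) (E : finType) (X : nat -> T -> E) :
    set_system T :=
  <<s [set A | exists n x, A = X n @^-1` [set x]] >>.

Definition sigma_of_noise (R : realType) (d : measure_display)
    (T : measurableType d) (Y : nat -> {mfun T >-> measurableTypeR R}) :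
    set_system T :=
  <<s [set A | exists n (B : set (measurableTypeR R)),
         measurable B /\ A = Y n @^-1` B] >>.

Definition independent_processes (R : realType) (d : measure_display)
    (T : measurableType d) (E : finType) (P : probability T R)
    (X : nat -> T -> E) (Y : nat -> {mfun T >-> measurableTypeR R}) : Prop :=
  forall A B : set T, sigma_of_chain X A -> sigma_of_noise Y B ->
    P (A `&` B) = (P A * P B)%E.

Definition stopping_strategy (R : realType) (E : finType) (p : E -> R) : Prop :=
  forall x, 0 <= p x <= 1.

Definition pure_strategy (R : realType) (E : finType) (p : E -> R) : Prop :=
  forall x, p x = 0 \/ p x = 1.

(* [None] encodes the value infinity. *)
Definition stopping_time (R : realType) (T : Type) (E : finType)
    (X : nat -> T -> E) (Y : nat -> T -> R) (p : E -> R) (w : T) : option nat :=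
  match pselect (exists n, Y n w <= p (X n w)) with
  | left H => Some (ex_minn H)
  | right _ => None
  end.

(* [limn] takes a default value when the limit does not exist, which for an
   absorbing chain happens on a null set only. *)
Definition stopped (R : realType) (T : Type) (E : finType)
    (X : nat -> T -> E) (Y : nat -> T -> R) (p : E -> R) (u : E -> R)
    (w : T) : R :=
  match stopping_time X Y p w with
  | Some n => u (X n w)
  | None => limn (fun n => u (X n w))
  end.

Definition expect (R : realType) (d : measure_display) (T : measurableType d)
    (P : probability T R) (Z : T -> R) : R :=
  fine ('E_P[Z])%E.

Definition stopped_value (R : realType) (d : measure_display)
    (T : measurableType d) (E : finType) (P : E -> probability T R)
    (X : nat -> T -> E) (Y : nat -> T -> R) (u : E -> R) (p : E -> R)
    (x : E) : R :=
  expect (P x) (stopped X Y p u).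

Definition payoff (R : realType) (d : measure_display)
    (T : measurableType d) (E : finType) (P : E -> probability T R)
    (X : nat -> T -> E) (Y : nat -> T -> R) (f h : E -> R) (g : R -> R)
    (p : E -> R) (x : E) : R :=
  stopped_value P X Y f p x + g (stopped_value P X Y h p x).

Definition equilibrium (R : realType) (d : measure_display)
    (T : measurableType d) (E : finType) (P : E -> probability T R)
    (X : nat -> T -> E) (Y : nat -> T -> R) (f h : E -> R) (g : R -> R)
    (p : E -> R) : Prop :=
  stopping_strategy p /\
  forall (q : R) (x : E), 0 <= q <= 1 ->
    q * f x
      + (1 - q) * expect (P x) (fun w => stopped_value P X Y f p (X 1%N w))
      + g (q * h x
           + (1 - q) * expect (P x) (fun w => stopped_value P X Y h p (X 1%N w)))
    <= payoff P X Y f h g p x.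

Definition pure_equilibrium (R : realType) (d : measure_display)
    (T : measurableType d) (E : finType) (P : E -> probability T R)
    (X : nat -> T -> E) (Y : nat -> T -> R) (f h : E -> R) (g : R -> R)
    (p : E -> R) : Prop :=
  equilibrium P X Y f h g p /\ pure_strategy p.

Definition equivalent_equilibria (R : realType) (d : measure_display)
    (T : measurableType d) (E : finType) (P : E -> probability T R)
    (X : nat -> T -> E) (Y : nat -> T -> R) (f h : E -> R) (g : R -> R)
    (p p' : E -> R) : Prop :=
  [/\ equilibrium P X Y f h g p,
      equilibrium P X Y f h g p'
    & forall x, payoff P X Y f h g p x = payoff P X Y f h g p' x].

Definition purify (R : realType) (E : finType) (p : E -> R) (x : E) : R :=
  if 0 < p x < 1 then 1 else p x.

(* Main.v *)
(* Since the strategy is stationary, the values phi = phi_p and psi = psi_p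
   satisfy the one-step equation phi = p f + (1 - p) Q phi, and phi = f at
   absorbing states.  Where 0 < phat < 1, the one-step deviation payoff is a
   convex function of q with an interior maximum; strict convexity of g forces
   it to be constant, that is, f = phi and h = psi there.  Hence phi solves the
   one-step equation of the purified strategy as well, and the maximum principle
   for an absorbing chain makes that solution unique.

   There are no shift operators on the probability space, so the one-step
   equation is obtained by computing E_x(f(X stopped at min(tau_p, n))) exactly,
   as the n-th iterate of the one-step operator applied to f, and letting n tend
   to infinity by dominated convergence, the chain being almost surely
   eventually constant. *)
Require Import Defs.
From HB Require Import structures.
From mathcomp Require Import all_boot all_order all_algebra.
From mathcomp Require Import all_classical all_reals all_analysis.
From mathcomp Require Import measurable_realfun.
From mathcomp Require Import ring lra.
Import Order.TTheory GRing.Theory Num.Theory.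
Import numFieldNormedType.Exports.

Set Implicit Arguments.
Unset Strict Implicit.
Unset Printing Implicit Defensive.

Local Open Scope classical_set_scope.
Local Open Scope ring_scope.

(** * Uniform noise, finite-valued variables and measurability of pointwise limits *)

Lemma uniform01_Iic (R : realType) (a : R) : 0 <= a <= 1 ->
  uniform_prob (@ltr01 R) (`]-oo, a] : set (measurableTypeR R)) = a%:E.
Proof.
move=> /andP[a0 a1]; rewrite /uniform_prob integral_uniform_pdf.
rewrite (_ : _ `&` _ = `[0, a]%classic); last first.
  apply/seteqP; split => x /=; rewrite !in_itv /=.
    by move=> [xa /andP[-> _]].
  by move=> /andP[-> xa]; rewrite xa (le_trans xa a1).
rewrite (eq_integral (fun=> 1%E)); last first.
  move=> x; rewrite inE /= in_itv /= => /andP[x0 xa].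
  by rewrite /uniform_pdf x0 (le_trans xa a1) subr0 invr1.
rewrite integral_cst//= mul1e lebesgue_measure_itv /= lte_fin.
by case: ltP => [_|a0']; rewrite -?EFinB ?subr0 //; congr EFin; lra.
Qed.

Lemma fine_prob_partition (R : realType) (d : measure_display)
    (T : measurableType d) (P : probability T R) (F : finType) (Z : T -> F)
    (B : set T) :
  (forall v, measurable (Z @^-1` [set v])) -> measurable B ->
  fine (P B) = \sum_v fine (P (B `&` Z @^-1` [set v])).
Proof.
move=> mZ mB.
have mBZ v : measurable (B `&` Z @^-1` [set v]) by exact: measurableI.
have integrableBZ v : P.-integrable setT
    (fun w => (\1_(B `&` Z @^-1` [set v]) w)%:E) by exact: integrable_indic.
have -> : P B = (\int[P]_w (\sum_v (\1_(B `&` Z @^-1` [set v]) w)%:E)%R)%E.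
  rewrite -[in LHS](setIT B) -integral_indic//; apply: eq_integral => w _.
  rewrite (bigD1 (Z w))//= big1 ?addr0 => [|v vw].
    by rewrite !indicE in_setI (@mem_set _ (Z @^-1` [set Z w]))// andbT.
  rewrite indicE memNset//= => -[_ /esym/eqP]; exact/negP.
rewrite integral_sum// -sum_fine => [|v _]; last exact: integrable_fin_num.
by apply: eq_bigr => v _; rewrite integral_indic// setIT.
Qed.

Lemma expect_finite (R : realType) (d : measure_display)
    (T : measurableType d) (P : probability T R) (F : finType) (Z : T -> F)
    (u : F -> R) :
  (forall v, measurable (Z @^-1` [set v])) ->
  expect P (u \o Z) = \sum_v u v * fine (P (Z @^-1` [set v])).
Proof.
move=> mZ; rewrite /expect unlock.
rewrite (eq_integral (fun w => \sum_v ((u v)%:E * (\1_(Z @^-1` [set v]) w)%:E)%E))%R; last first.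
  move=> w _; rewrite (bigD1 (Z w))//= indicE mem_set// mule1 big1 ?adde0//.
  move=> v vw; rewrite indicE memNset ?mule0//= => /esym/eqP.
  exact/negP.
rewrite integral_sum //; last first.
  by move=> v; apply: integrableZl => //; exact: integrable_indic.
rewrite -sum_fine; last first.
  move=> v _; rewrite integralZl//; last exact: integrable_indic.
  by rewrite integral_indic// fin_numM// fin_num_measure//; exact: measurableI.
apply: eq_bigr => v _; rewrite integralZl//; last exact: integrable_indic.
by rewrite integral_indic// setIT fineM// fin_num_measure.
Qed.

Lemma measurable_fun_limn (R : realType) (d : measure_display)
    (T : measurableType d) (Z : nat -> T -> R) :
  (forall n, measurable_fun setT (Z n)) ->
  measurable_fun setT (fun w => limn (fun n => Z n w)).
Proof.
move=> mZ.
(* [C] is the Cauchy criterion with the quantifiers restricted to countable sets, which makes it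
   visibly measurable. *)
pose C := \bigcap_k \bigcup_N \bigcap_(n in [set n | (N <= n)%N])
  [set w | `|Z N w - Z n w| < k.+1%:R^-1].
have CE w : C w <-> cvgn (fun n => Z n w).
  split => [Cw|cZ].
    apply: cauchy_cvg; apply: cauchy_exP => _/posnumP[e] /=.
    have [k _ /(_ k (leqnn k)) ke] := near_infty_natSinv_lt e.
    have [N _ CN] := Cw k I.
    exists (Z N w), N => // n /= Nn.
    by apply: lt_trans ke; exact: CN.
  move=> k _; have k0 : 0 < k.+1%:R^-1 :> R by rewrite invr_gt0.
  have k2 : 0 < k.+1%:R^-1 / 2 :> R by rewrite divr_gt0.
  have /cvgrPdist_lt/(_ _ k2)[N _ lN] := cZ.
  exists N => // n /= Nn.
  rewrite [ltRHS]splitr; apply: le_lt_trans (ler_distD (limn (Z ^~ w)) _ _) _.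
  by rewrite ltrD //; [rewrite distrC|]; apply: lN => /=.
have mC : measurable C.
  apply: bigcapT_measurable => k; apply: bigcupT_measurable => N.
  apply: bigcap_measurable; first by exists N => /=.
  move=> n _.
  have -> : [set w | `|Z N w - Z n w| < k.+1%:R^-1] = (fun w => `|Z N w - Z n w| < k.+1%:R^-1) @^-1` [set true] by [].
  rewrite -[X in measurable X]setTI; apply: measurable_fun_ltr => //.
  by apply: measurableT_comp => //; exact: measurable_funB.
(* Off [C] there is no limit and [limn] returns its default [point], so the function is constant
   there; no convergence assumption is necessary. *)
have -> : (fun w => limn (fun n => Z n w)) =
    (fun w => if `[<C w>] then limn (fun n => Z n w) else point).
  apply/funext => w; case: ifPn => // /asboolPn nC.
  by rewrite dvgP// => /CE.
have mCb : measurable_fun setT (fun w => `[<C w>]).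
  apply: (measurable_fun_bool true); rewrite setTI.
  rewrite (_ : _ @^-1` _ = C)//; apply/seteqP; split => w /=.
    by move/asboolP.
  by move=> Cw; apply/asboolP.
apply: measurable_fun_if => //.
apply: (@measurable_fun_cvg _ _ _ _ Z).
  by move=> n; exact: measurable_funTS.
by move=> w [_ /asboolP /CE].
Qed.

(** * Joint law of the chain and the noise *)

Section noisy_chain.
Context (R : realType) (d : measure_display) (T : measurableType d)
  (E : finType) (P : probability T R) (X : nat -> T -> E) (Q : E -> E -> R)
  (Y : nat -> {mfun T >-> measurableTypeR R}).
Hypothesis mX : forall n x, measurable (X n @^-1` [set x]).
Hypothesis Q_stochastic : stochastic Q.
Hypothesis X_markov : forall n (e : nat -> E),
  P (path_event X n.+1 e) = (P (path_event X n e) * (Q (e n) (e n.+1))%:E)%E.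
Hypothesis Y_iid : iid_uniform01 P Y.
Hypothesis XY_indep : independent_processes P X Y.

Let U (B : set (measurableTypeR R)) : R := fine (uniform_prob (@ltr01 R) B).

Lemma path_eventE n e :
  path_event X n e = \big[setI/setT]_(i < n.+1) (X i @^-1` [set e i]).
Proof.
rewrite -(@bigcap_mkord _ n.+1 (fun i => X i @^-1` [set e i])).
by apply/seteqP; split => w /= H i /=; exact: H.
Qed.

Lemma measurable_path_event n e : measurable (path_event X n e).
Proof. by rewrite path_eventE; exact: bigsetI_measurable. Qed.

Definition noise_event m (B : nat -> set (measurableTypeR R)) : set T :=
  [set w | forall i, (i < m)%N -> B i (Y i w)].

Lemma noise_eventE m B :
  noise_event m B = \big[setI/setT]_(i < m) (Y i @^-1` B i).
Proof.
by rewrite -(@bigcap_mkord _ m (fun i => Y i @^-1` B i)).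
Qed.

Lemma measurable_noise_event m (B : nat -> set (measurableTypeR R)) :
  (forall i, measurable (B i)) -> measurable (noise_event m B).
Proof.
move=> mB; rewrite noise_eventE; apply: bigsetI_measurable => i _.
exact: measurable_funPTI.
Qed.

Lemma prob_noise_event m (B : nat -> set (measurableTypeR R)) :
  (forall i, measurable (B i)) ->
  fine (P (noise_event m B)) = \prod_(i < m) U (B i).
Proof.
move=> mB; have [Yunif Yprod] := Y_iid.
have := Yprod (index_iota 0 m) B (iota_uniq _ _) mB.
rewrite !big_mkord noise_eventE => ->.
transitivity (fine (\prod_(i < m) (U (B i))%:E)%E).
  congr fine; apply: eq_bigr => i _; rewrite Yunif// fineK//.
  exact: fin_num_measure.
by rewrite prodEFin.
Qed.

Lemma prob_path_noise n e m (B : nat -> set (measurableTypeR R)) :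
  (forall i, measurable (B i)) ->
  fine (P (path_event X n e `&` noise_event m B)) =
  fine (P (path_event X n e)) * \prod_(i < m) U (B i).
Proof.
move=> mB; rewrite -prob_noise_event// XY_indep.
- rewrite fineM//; apply: fin_num_measure; first exact: measurable_path_event.
  exact: measurable_noise_event.
- rewrite path_eventE.
  apply: (@bigsetI_measurable _ (g_sigma_algebraType
    [set A | exists n x, A = X n @^-1` [set x]])) => i _.
  by apply: sub_sigma_algebra; exists i, (e i).
- rewrite noise_eventE.
  apply: (@bigsetI_measurable _ (g_sigma_algebraType
    [set A | exists n (B : set (measurableTypeR R)),
         measurable B /\ A = Y n @^-1` B])) => i _.
  by apply: sub_sigma_algebra; exists i, (B i).
Qed.

(** [c y] stands for the noise values that let the process go on from [y]. Only times below [k] are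
    constrained, so the decision at time [k] is still open. Keeping [c] general allows the full
    sets, for which survival is no condition and one recovers the chain alone. *)
Definition survive (c : E -> set (measurableTypeR R)) k : set T :=
  [set w | forall i, (i < k)%N -> c (X i w) (Y i w)].

(** A value in a finite type, so that an event can be split into finitely many pieces along each of
    which the path, and hence each set [c (X i w)], is fixed. *)
Definition history k (w : T) : {ffun 'I_k.+1 -> E} := [ffun i : 'I_k.+1 => X i w].

Lemma history_preimage k (v : {ffun 'I_k.+1 -> E}) :
  history k @^-1` [set v] = path_event X k (fun i => v (inord i)).
Proof.
apply/seteqP; split => w /=.
  by move=> <- i ik; rewrite ffunE inordK.
by move=> H; apply/ffunP => i; rewrite ffunE H ?inord_val// -ltnS.
Qed.

Lemma measurable_history k (v : {ffun 'I_k.+1 -> E}) :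
  measurable (history k @^-1` [set v]).
Proof. by rewrite history_preimage; exact: measurable_path_event. Qed.

Section survival.
Variable c : E -> set (measurableTypeR R).
Hypothesis mc : forall y, measurable (c y).

Lemma measurable_survive k : measurable (survive c k).
Proof.
have -> : survive c k = \bigcup_(v in [set: {ffun 'I_k.+1 -> E}])
    (history k @^-1` [set v] `&` noise_event k (fun i => c (v (inord i)))).
  apply/seteqP; split => [w Sw|w [v _ []]].
    exists (history k w) => //; split => // i ik.
    by rewrite ffunE (inordK (leqW ik)); exact: Sw.
  rewrite history_preimage => Xv Sw i ik.
  by rewrite (Xv _ (ltnW ik)); exact: Sw.
apply: fin_bigcup_measurable => // v _.
by apply: measurableI; [exact: measurable_history|exact: measurable_noise_event].
Qed.

(** Along a fixed history the event is the intersection of a path event and a noise event, so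
    independence factors it. [Y k] contributes its own factor because survival up to [k] involves
    only earlier noise, and the Markov property supplies [Q y z]. Summing over histories gives the
    claim. *)
Lemma survive_step k y z (B : set (measurableTypeR R)) : measurable B ->
  fine (P (survive c k `&` X k @^-1` [set y] `&` Y k @^-1` B
           `&` X k.+1 @^-1` [set z])) =
  fine (P (survive c k `&` X k @^-1` [set y])) * U B * Q y z.
Proof.
move=> mB.
have mS := measurable_survive k.
have mYB : measurable (Y k @^-1` B) by exact: measurable_funPTI.
have mSX : measurable (survive c k `&` X k @^-1` [set y]) by exact: measurableI.
rewrite (fine_prob_partition P (@measurable_history k)); last first.
  by apply: measurableI => //; exact: measurableI.
rewrite [in RHS](fine_prob_partition P (@measurable_history k))//.
rewrite !mulr_suml; apply: eq_bigr => v _.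
(* A history that does not end at [y] contributes nothing to either side. *)
have [vy|vy] := eqVneq (v ord_max) y; last first.
  have Xy w : history k w = v -> X k w = y -> False.
    by move=> Hv Xk; move/eqP: vy; apply; rewrite -Hv ffunE.
  rewrite (_ : _ `&` _ = set0); last first.
    by rewrite -subset0 => w /= [[[[_ /= Xk] _] _] Hv]; exact: (Xy w).
  rewrite (_ : survive c k `&` _ `&` _ = set0); last first.
    by rewrite -subset0 => w /= [[_ /= Xk] Hv]; exact: (Xy w).
  by rewrite measure0 /= !mul0r.
(* [e] prolongs the history by the step to [z]; [C] asks for continuation along it before time [k]
   and for [B] at time [k]. *)
pose e i := if (i <= k)%N then v (inord i) else z.
pose C i := if (i < k)%N then c (e i) else B.
have eK : e k = y by rewrite /e leqnn -vy; congr (v _); apply/val_inj; rewrite /= inordK.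
have eS : e k.+1 = z by rewrite /e ltnn.
have mC i : measurable (C i) by rewrite /C; case: ifP.
have hE : history k @^-1` [set v] = path_event X k e.
  rewrite history_preimage; apply/seteqP; split => w /= H i ik.
    by rewrite H// /e ik.
  by rewrite H// /e ik.
have -> : survive c k `&` X k @^-1` [set y] `&` history k @^-1` [set v] =
    path_event X k e `&` noise_event k C.
  rewrite hE; apply/seteqP; split => w /=.
    move=> [[Sw _] pw]; split => // i ik.
    by rewrite /C ik -(pw _ (ltnW ik)); exact: Sw.
  move=> [pw Cw]; split => //; split; last by rewrite /= pw.
  by move=> i ik; have := Cw i ik; rewrite /C ik -(pw _ (ltnW ik)).
have -> : survive c k `&` X k @^-1` [set y] `&` Y k @^-1` B
    `&` X k.+1 @^-1` [set z] `&` history k @^-1` [set v] =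
    path_event X k.+1 e `&` noise_event k.+1 C.
  rewrite hE; apply/seteqP; split => w /=.
    move=> [[[[Sw _] Bw] Xz] pw]; split => i.
      by rewrite leq_eqVlt => /predU1P[->|/pw//]; rewrite eS.
    rewrite ltnS leq_eqVlt => /predU1P[->|ik]; first by rewrite /C ltnn.
    by rewrite /C ik -(pw _ (ltnW ik)); exact: Sw.
  move=> [pw Cw]; split; last by move=> i ik; apply: pw; rewrite leqW.
  split; last by rewrite /= pw.
  split; last by have := Cw k (ltnSn k); rewrite /C ltnn.
  split; last by rewrite /= pw.
  by move=> i ik; have := Cw i (leqW ik); rewrite /C ik -(pw _ (leqW (ltnW ik))).
rewrite !prob_path_noise// X_markov eK eS fineM//; last first.
  by apply: fin_num_measure; exact: measurable_path_event.
rewrite big_ord_recr /= (_ : C k = B) ?/C ?ltnn//; ring.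
Qed.

Lemma survive_noise k y (B : set (measurableTypeR R)) : measurable B ->
  fine (P (survive c k `&` X k @^-1` [set y] `&` Y k @^-1` B)) =
  fine (P (survive c k `&` X k @^-1` [set y])) * U B.
Proof.
move=> mB; have mS := measurable_survive k.
have mYB : measurable (Y k @^-1` B) by exact: measurable_funPTI.
rewrite (fine_prob_partition P (mX k.+1)); last first.
  by apply: measurableI => //; exact: measurableI.
under eq_bigr do rewrite survive_step//.
by rewrite -mulr_sumr Q_stochastic.2 mulr1.
Qed.

Lemma surviveS k : survive c k.+1 =
  [set w | survive c k w /\ c (X k w) (Y k w)].
Proof.
apply/seteqP; split => w /=; first by move=> Sw; split => [i ik|]; apply: Sw => //; exact: leqW.
by move=> [Sw cw] i; rewrite ltnS leq_eqVlt => /predU1P[->//|]; exact: Sw.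
Qed.

(** A sub-probability in [y]: the mass sitting at [y] at time [k] that was not stopped earlier. *)
Definition survival_law k y : R := fine (P (survive c k `&` X k @^-1` [set y])).

Lemma survival_law_stay k y :
  fine (P (survive c k.+1 `&` X k @^-1` [set y])) = survival_law k y * U (c y).
Proof.
rewrite /survival_law -survive_noise// surviveS; congr (fine (P _)).
apply/seteqP; split => w /=.
  by move=> [[Sw cw] Xy]; rewrite Xy in cw.
by move=> [[Sw Xy] cw]; rewrite Xy.
Qed.

Lemma survival_lawS k z :
  survival_law k.+1 z = \sum_y survival_law k y * U (c y) * Q y z.
Proof.
rewrite /survival_law (fine_prob_partition P (mX k)); last first.
  by apply: measurableI => //; exact: measurable_survive.
apply: eq_bigr => y _; rewrite -survive_step// surviveS; congr (fine (P _)).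
apply/seteqP; split => w /=.
  by move=> [[[Sw cw] Xz] Xy]; rewrite Xy in cw.
by move=> [[[Sw Xy] cw] Xz]; rewrite Xy.
Qed.

End survival.

Definition law k y : R := fine (P (X k @^-1` [set y])).

Lemma law_survival n y : law n y = survival_law (fun=> setT) n y.
Proof.
rewrite /law /survival_law; congr (fine (P _)).
by rewrite (_ : survive _ _ = setT) ?setTI//; apply/seteqP; split.
Qed.

Lemma law_step k y z :
  fine (P (X k @^-1` [set y] `&` X k.+1 @^-1` [set z])) = law k y * Q y z.
Proof.
have -> : X k @^-1` [set y] `&` X k.+1 @^-1` [set z] =
    survive (fun=> setT) k `&` X k @^-1` [set y] `&` Y k @^-1` setT
    `&` X k.+1 @^-1` [set z].
  by apply/seteqP; split => w /= => [[]|[[[]]]].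
rewrite survive_step// law_survival /U.
by rewrite (probability_setT (uniform_prob (@ltr01 R))) mulr1.
Qed.

Lemma lawS k z : law k.+1 z = \sum_y law k y * Q y z.
Proof.
rewrite /law (fine_prob_partition P (mX k))//.
by apply: eq_bigr => y _; rewrite setIC law_step.
Qed.

Lemma law_start x y : P (X 0%N @^-1` [set x]) = 1%E -> law 0 y = (x == y)%:R.
Proof.
move=> X0; rewrite /law; have [<-|xy] := eqVneq x y; first by rewrite X0.
suff -> : P (X 0%N @^-1` [set y]) = 0%E by [].
apply/eqP; rewrite eq_le measure_ge0 andbT.
have <- : P (~` (X 0%N @^-1` [set x])) = 0%E.
  by rewrite probability_setC// X0 subee.
apply: le_measure; rewrite ?inE//; first exact: measurableC.
by move=> w /= -> yx; move/eqP: xy; apply.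
Qed.

End noisy_chain.

(** * The chain stopped at a bounded time, and the passage to the limit *)

Section stopped_chain.
Context (R : realType) (d : measure_display) (T : measurableType d)
  (E : finType) (P : probability T R) (X : nat -> T -> E) (Q : E -> E -> R)
  (Y : nat -> {mfun T >-> measurableTypeR R}) (p : E -> R).
Hypothesis mX : forall n x, measurable (X n @^-1` [set x]).
Hypothesis Q_stochastic : stochastic Q.
Hypothesis X_markov : forall n (e : nat -> E),
  P (path_event X n.+1 e) = (P (path_event X n e) * (Q (e n) (e n.+1))%:E)%E.
Hypothesis Y_iid : iid_uniform01 P Y.
Hypothesis XY_indep : independent_processes P X Y.
Hypothesis p01 : stopping_strategy p.

Definition continue_set y : set (measurableTypeR R) := ~` `]-oo, p y]%classic.

Lemma measurable_continue_set y : measurable (continue_set y).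
Proof. by apply: measurableC; exact: measurable_itv. Qed.
Let mc := measurable_continue_set.

Lemma prob_continue_set y :
  fine (uniform_prob (@ltr01 R) (continue_set y)) = 1 - p y.
Proof.
have mI : measurable (`]-oo, p y]%classic : set (measurableTypeR R)).
  exact: measurable_itv.
have := probability_setC (uniform_prob (@ltr01 R)) mI.
move=> /= ->; rewrite uniform01_Iic//; exact: p01.
Qed.

Local Notation S := (survive X Y continue_set).
Local Notation a := (survival_law P X Y continue_set).

(* [halted n] is [X] stopped at time min(tau_p, n). *)
Fixpoint halted (n : nat) (w : T) : E :=
  if n is m.+1 then if `[< S m.+1 w >] then X m.+1 w else halted m w
  else X 0%N w.

Lemma halted_survive n w : S n w -> halted n w = X n w.
Proof. by case: n => [//|n] Sw /=; rewrite asboolT. Qed.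

Lemma survive_le m n w : (m <= n)%N -> S n w -> S m w.
Proof. by move=> mn Sw i im; apply: Sw; exact: leq_trans mn. Qed.

Lemma halted_stop k n w : S k w -> Y k w <= p (X k w) -> (k <= n)%N ->
  halted n w = X k w.
Proof.
move=> Sw Yp; elim: n => [|n IHn].
  by rewrite leqn0 => /eqP ->.
rewrite leq_eqVlt => /predU1P[<-|kn]; first exact: halted_survive.
rewrite /= asboolF ?IHn// => /(_ k kn).
by rewrite /continue_set /= in_itv /= Yp.
Qed.

Lemma halted_continue w : ~ (exists n, Y n w <= p (X n w)) ->
  forall n, halted n w = X n w.
Proof.
move=> nY n; rewrite halted_survive// => i _.
by rewrite /continue_set /= in_itv /= => Yi; apply: nY; exists i.
Qed.

Lemma halted_stop_cvg (u : E -> R) w k : S k w -> Y k w <= p (X k w) ->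
  u (halted n w) @[n --> \oo] --> u (X k w).
Proof.
move=> Sw Yk; apply: cvg_near_cst; exists k => // n /= kn.
by rewrite (@halted_stop k).
Qed.

(** This holds for every [w], even where the chain does not converge: if stopping occurs, the halted
    sequence is eventually constant; otherwise it is the chain itself and both sides are the same
    [limn], default value included. Measurability of [stopped] follows from it. *)
Lemma stopped_halted (u : E -> R) w :
  stopped X (fun n => Y n) p u w = limn (fun n => u (halted n w)).
Proof.
rewrite /stopped /stopping_time; case: pselect => [H|nH].
  case: ex_minnP => k Yk kmin.
  suff Sw : S k w.
    by rewrite (cvg_lim (@Rhausdorff R) (halted_stop_cvg (u := u) Sw Yk)).
  move=> i ik; rewrite /continue_set /= in_itv /= => Yi.
  by have := kmin i Yi; rewrite leqNgt ik.
rewrite (_ : (fun n => u (halted n w)) = (fun n => u (X n w)))//.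
by apply/funext => n; rewrite halted_continue.
Qed.

Lemma halted_cvg (u : E -> R) w : cvgn (fun n => u (X n w)) ->
  u (halted n w) @[n --> \oo] --> stopped X (fun n => Y n) p u w.
Proof.
rewrite stopped_halted => Xw; have [H|nH] := pselect (exists n, Y n w <= p (X n w)).
  case: (ex_minnP H) => k Yk kmin.
  suff Sw : S k w by apply: cvgP; exact: halted_stop_cvg Sw Yk.
  move=> i ik; rewrite /continue_set /= in_itv /= => Yi.
  by have := kmin i Yi; rewrite leqNgt ik.
rewrite (_ : (fun n => u (halted n w)) = (fun n => u (X n w)))//.
by apply/funext => n; rewrite halted_continue.
Qed.

Lemma haltedS_preimage n y : halted n.+1 @^-1` [set y] =
  (S n.+1 `&` X n.+1 @^-1` [set y]) `|` (halted n @^-1` [set y] `\` S n.+1).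
Proof.
apply/seteqP; split => w /=.
  by case: asboolP => Sw Hw; [left|right].
by move=> [[Sw Xw]|[Hw Sw]]; [rewrite asboolT|rewrite asboolF].
Qed.

Lemma measurable_halted n y : measurable (halted n @^-1` [set y]).
Proof.
elim: n => [|n IHn]; first exact: mX.
have mS := measurable_survive Y mX mc n.+1.
rewrite haltedS_preimage; apply: measurableU; first exact: measurableI.
exact: measurableD.
Qed.

(** Mass balance: between times [n] and [n.+1] the halted chain leaves [y] with the mass that was
    running there and continues, and receives at [y] the mass that is running there at the new
    time. *)
Lemma halted_law n y :
  fine (P (halted n.+1 @^-1` [set y])) =
  fine (P (halted n @^-1` [set y])) - a n y * (1 - p y) + a n.+1 y.
Proof.
have mS := measurable_survive Y mX mc n.+1; have mH := measurable_halted n y.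
rewrite haltedS_preimage measureU; [|exact: measurableI|exact: measurableD|].
  2: by rewrite -subset0 => w [[]] ? _ [].
rewrite fineD ?fin_num_measure//; [|exact: measurableI|exact: measurableD].
rewrite addrC; congr (_ + _).
rewrite measureD// ?fineB ?fin_num_measure//; [|exact: measurableI|].
  2: by rewrite -ge0_fin_numE// fin_num_measure.
congr (_ - _); rewrite -prob_continue_set
  -(survival_law_stay mX Q_stochastic X_markov Y_iid XY_indep mc).
congr (fine (P _)); apply/seteqP; split => w /=.
  by move=> [Hw Sw]; split => //; rewrite -halted_survive//; exact: survive_le Sw.
by move=> [Sw Xw]; split => //; rewrite halted_survive//; exact: survive_le Sw.
Qed.

Fixpoint iterate_value (u : E -> R) n x : R :=
  if n is m.+1 then
    p x * u x + (1 - p x) * \sum_y Q x y * iterate_value u m y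
  else u x.

Lemma expect_halted x (u : E -> R) n : P (X 0%N @^-1` [set x]) = 1%E ->
  expect P (u \o halted n) = iterate_value u n x.
Proof.
move=> X0; rewrite (expect_finite _ _ (measurable_halted n)).
have a0_law y : a 0 y = law P X 0 y.
  by rewrite /survival_law (_ : S 0 = setT) ?setTI//; apply/seteqP; split.
have sum_a0 (v : E -> R) : \sum_y a 0 y * v y = v x.
  rewrite (bigD1 x)//= a0_law (law_start mX _ X0) eqxx mul1r big1 ?addr0// => y yx.
  by rewrite a0_law (law_start mX _ X0) eq_sym (negbTE yx) mul0r.
(* The first two sums keep the mass already stopped by time [n]; the third
   replaces the running mass by its value with [m] further steps to go. *)
suff : forall m, \sum_y u y * fine (P (halted n @^-1` [set y]))
    - \sum_y a n y * u y + \sum_y a n y * iterate_value u m y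
    = iterate_value u (n + m) x.
  by move=> /(_ 0%N); rewrite addn0 subrK.
elim: n => [|n IHn] m.
  rewrite (eq_bigr (fun y => a 0 y * u y)) ?subrr ?add0r ?add0n ?sum_a0// => y _.
  by rewrite mulrC a0_law.
(* One unit of time moves from the remaining steps [m] to the elapsed time [n]. The induction
   hypothesis is used at [m.+1], hence the quantification over [m]. *)
rewrite addSnnS -IHn.
have -> : \sum_y u y * fine (P (halted n.+1 @^-1` [set y])) =
    \sum_y u y * fine (P (halted n @^-1` [set y])) - \sum_y a n y * u y
    + \sum_y a n y * (p y * u y) + \sum_y a n.+1 y * u y.
  rewrite -sumrB -!big_split /=; apply: eq_bigr => y _.
  by rewrite halted_law; ring.
have -> : \sum_y a n.+1 y * iterate_value u m y =
    \sum_y a n y * ((1 - p y) * \sum_z Q y z * iterate_value u m z).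
  under eq_bigr do
    rewrite (survival_lawS mX X_markov Y_iid XY_indep mc) mulr_suml.
  rewrite exchange_big /=; apply: eq_bigr => y _.
  rewrite mulrA mulr_sumr; apply: eq_bigr => z _.
  by rewrite prob_continue_set; ring.
have -> : \sum_y a n y * iterate_value u m.+1 y = \sum_y a n y * (p y * u y)
    + \sum_y a n y * ((1 - p y) * \sum_z Q y z * iterate_value u m z).
  by rewrite -big_split /=; apply: eq_bigr => y _; rewrite mulrDr.
ring.
Qed.

Lemma stopped_value_cvg x (u : E -> R) : P (X 0%N @^-1` [set x]) = 1%E ->
  {ae P, forall w, cvgn (fun n => u (X n w))} ->
  iterate_value u n x @[n --> \oo] --> expect P (stopped X (fun n => Y n) p u).
Proof.
move=> X0 Xcvg.
have mH n : measurable_fun setT (u \o halted n).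
  move=> _ B _; rewrite setTI (_ : _ @^-1` B =
      \bigcup_(y in u @^-1` B) (halted n @^-1` [set y])).
    by apply: fin_bigcup_measurable => // y _; exact: measurable_halted.
  apply/seteqP; split => [w Bw|w [y By Hw]]; first by exists (halted n w).
  by rewrite /preimage /= Hw.
have mstop : measurable_fun setT (stopped X (fun n => Y n) p u).
  rewrite (_ : stopped _ _ _ _ = fun w => limn (fun n => (u \o halted n) w)).
    exact: measurable_fun_limn.
  by apply/funext => w; exact: stopped_halted.
(* Since [E] is finite, this constant dominates [u] along every path, and constants are integrable
   for a probability. *)
pose M : R := \sum_y `|u y|.
have [|||||intS _] := @dominated_convergence _ _ _ P setT measurableT
  (fun n w => (u (halted n w))%:E) (fun w => (stopped X (fun n => Y n) p u w)%:E)
  (fun=> M%:E).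
- by move=> n; apply/measurable_EFinP; exact: mH.
- exact/measurable_EFinP.
- apply: filterS Xcvg => w Xw _.
  apply: cvg_EFin; first exact: nearW.
  exact: halted_cvg.
- exact: finite_measure_integrable_cst.
- apply: aeW => w n _; rewrite lee_fin /M (bigD1 (halted n w))//= lerDl.
  exact: sumr_ge0.
rewrite -(fineK (integrable_fin_num measurableT intS)) => /fine_cvg.
rewrite /expect unlock; apply: cvg_trans.
apply: near_eq_cvg; apply: nearW => n.
by rewrite /= -(expect_halted u n X0) /expect unlock.
Qed.

End stopped_chain.

(** * Absorption, the maximum principle and the one-step equation *)

Section absorbing.
Context (R : realType) (d : measure_display) (T : measurableType d)
  (E : finType) (P : E -> probability T R) (X : nat -> T -> E) (Q : E -> E -> R)
  (Y : nat -> {mfun T >-> measurableTypeR R}).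
Hypothesis X_markov : markov_chain P X Q.
Hypothesis X_absorbing : absorbing_chain P X Q.
Hypothesis Y_iid : forall x, iid_uniform01 (P x) Y.
Hypothesis XY_indep : forall x, independent_processes (P x) X Y.

Let mX : forall n x, measurable (X n @^-1` [set x]).
Proof. by case: X_markov. Qed.
Let Q_ge0 x y : 0 <= Q x y. Proof. by case: X_markov => _ [] + _ _ _; exact. Qed.
Let Q_sum1 x : \sum_y Q x y = 1. Proof. by case: X_markov => _ [] _ + _ _; exact. Qed.
Let X_start x : P x (X 0%N @^-1` [set x]) = 1%E.
Proof. by case: X_markov => _ _ + _; exact. Qed.
Let X_step x n e : P x (path_event X n.+1 e)
  = (P x (path_event X n e) * (Q (e n) (e n.+1))%:E)%E.
Proof. by case: X_markov => _ _ _; exact. Qed.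

Local Notation law_from x := (law (P x) X).

Let lawS_last x k z : law_from x k.+1 z = \sum_y law_from x k y * Q y z.
Proof. exact: (lawS mX (@X_step x) (Y_iid x) (XY_indep x)). Qed.

Lemma law_ge0 x k y : 0 <= law_from x k y.
Proof. exact/fine_ge0/measure_ge0. Qed.

Let law0 x y : law_from x 0 y = (x == y)%:R.
Proof. exact: law_start. Qed.

(** The Markov property at the first step, here between different starting measures. It comes from
    the last-step recursion by induction, which amounts to associativity of the powers of [Q]. *)
Lemma lawS_first x k z : law_from x k.+1 z = \sum_y Q x y * law_from y k z.
Proof.
elim: k z => [|k IHk] z.
  rewrite lawS_last (bigD1 x)//= law0 eqxx mul1r big1 ?addr0 => [|y yx].
    rewrite (bigD1 z)//= law0 eqxx mulr1 big1 ?addr0// => y yz.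
    by rewrite law0 (negbTE yz) mulr0.
  by rewrite law0 eq_sym (negbTE yx) mul0r.
rewrite lawS_last; under eq_bigr do rewrite IHk mulr_suml.
rewrite exchange_big /=; apply: eq_bigr => y _.
by rewrite lawS_last mulr_sumr; apply: eq_bigr => w _; rewrite mulrA.
Qed.

Lemma law1 x y : law_from x 1 y = Q x y.
Proof.
rewrite lawS_first (bigD1 y)//= law0 eqxx mulr1 big1 ?addr0// => z zy.
by rewrite law0 (negbTE zy) mulr0.
Qed.

Lemma absorbing_neq a y : absorbing_state Q a -> y != a -> Q a y = 0.
Proof.
move=> aa ya; have := Q_sum1 a; rewrite (bigD1 a)//= aa -[RHS]addr0.
move/addrI/eqP; rewrite psumr_eq0// => /allP/(_ y (mem_index_enum y)).
by rewrite ya => /eqP.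
Qed.

Lemma absorbing_sum (v : E -> R) a :
  absorbing_state Q a -> \sum_y Q a y * v y = v a.
Proof.
move=> aa; rewrite (bigD1 a)//= aa mul1r big1 ?addr0// => y ya.
by rewrite absorbing_neq// mul0r.
Qed.

(* The maximum principle: where [|u|] is maximal and nonzero, [u] is an average
   of its values one step later, so the maximum propagates along the chain
   until it reaches an absorbing state. *)
Lemma harmonic_eq0 (u : E -> R) :
  (forall a, absorbing_state Q a -> u a = 0) ->
  (forall x, u x = 0 \/ u x = \sum_y Q x y * u y) ->
  forall x, u x = 0.
Proof.
move=> u_abs u_harm x.
case: (@Order.TotalTheory.arg_maxP _ _ E x predT (fun y => `|u y|) isT) => x0 _ x0_max.
have umax y : `|u y| <= `|u x0| by exact: x0_max.
have [u0|u0] := eqVneq (u x0) 0.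
  by apply/eqP; rewrite -normr_le0 (le_trans (umax x))// u0 normr0.
have propagate n : forall z, 0 < law_from x0 n z -> `|u z| = `|u x0|.
  elim: n => [|n IHn] z.
    by rewrite law0; case: eqVneq => [->//|_]; rewrite ltxx.
  rewrite lawS_last => sum_gt0.
  have [y ly] : exists y, 0 < law_from x0 n y * Q y z.
    apply/not_existsP => nz; move: sum_gt0; rewrite ltNge sumr_le0// => y _.
    by rewrite leNgt; apply/negP; exact: nz.
  have l0 : 0 < law_from x0 n y.
    rewrite lt_neqAle law_ge0 andbT eq_sym; apply: contraTneq ly => ->.
    by rewrite mul0r ltxx.
  have Q0 : 0 < Q y z by rewrite -(pmulr_rgt0 _ l0).
  have uy := IHn _ l0.
  apply/eqP; rewrite eq_le umax//= leNgt; apply/negP => uz.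
  (* Because [Q y z] is positive, a strictly smaller modulus at [z] would make the average at [y]
     strictly smaller too; if instead [u y] is zero, the maximum being nonzero gives the same
     inequality. *)
  have : `|u y| < `|u x0|.
    case: (u_harm y) => [->|->]; first by rewrite normr0 normr_gt0.
    apply: le_lt_trans (ler_norm_sum _ _ _) _.
    rewrite -[ltRHS]mul1r -(Q_sum1 y) mulr_suml.
    rewrite (bigD1 z)//= [ltRHS](bigD1 z)//=; apply: ltr_leD.
      by rewrite normrM ger0_norm// ltr_pM2l.
    by apply: ler_sum => w _; rewrite normrM ger0_norm// ler_wpM2l// umax.
  by rewrite uy ltxx.
have [a [n [aa Xa]]] := X_absorbing x0.
have /propagate : 0 < law_from x0 n a.
  by rewrite /law -lte_fin fineK// fin_num_measure.
rewrite u_abs// normr0 => /esym/eqP; rewrite normr_eq0.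
by rewrite (negbTE u0).
Qed.

(** The mass on non-absorbing states cannot grow, since absorbing states send nothing out, so it has
    a limit. As a function of the starting point this limit is harmonic, by the first-step
    decomposition, and it vanishes at absorbing states; the maximum principle makes it zero. *)
Lemma transient_cvg0 x :
  \sum_(y | Q y y != 1) law_from x n y @[n --> \oo] --> 0.
Proof.
pose b n x := \sum_(y | Q y y != 1) law_from x n y.
have b0 n y : 0 <= b n y by apply: sumr_ge0 => z _; exact: law_ge0.
have bS n y : b n.+1 y <= b n y.
  rewrite /b; under eq_bigr do rewrite lawS_last.
  rewrite exchange_big /= (bigID (fun z => Q z z != 1))/= [X in _ + X]big1 => [|z].
    rewrite addr0; apply: ler_sum => z _.
    rewrite -mulr_sumr -[leRHS]mulr1 ler_wpM2l ?law_ge0//.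
    rewrite -[leRHS](Q_sum1 z) [leRHS](bigID (fun w => Q w w != 1))/= lerDl.
    exact: sumr_ge0.
  move=> /negPn/eqP zz; apply: big1 => w ww.
  rewrite (@absorbing_neq z w zz) ?mulr0//.
  by apply: contraNneq ww => ->; rewrite zz.
have b_cvg y : cvgn (fun n => b n y).
  apply: nonincreasing_is_cvgn.
    by apply/nonincreasing_seqP => n; exact: bS.
  by exists 0 => _ [n _ <-].
suff lim0 : forall y, limn (fun n => b n y) = 0.
  by rewrite -[X in _ --> X](lim0 x); exact: b_cvg.
apply: harmonic_eq0 => [a aa|y].
  suff b_a n : b n a = 0.
    rewrite (_ : (fun n => b n a) = fun=> 0); first exact: lim_cst.
    by apply/funext.
  elim: n => [|n IHn]; last by apply/eqP; rewrite eq_le b0 -[leRHS]IHn bS.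
  apply: big1 => y yy; rewrite law0; case: eqVneq => // ay.
  by move: yy; rewrite -ay aa eqxx.
right; apply: cvg_lim => //.
rewrite -(cvg_shiftS (fun n => b n y)) /=.
rewrite (_ : (fun n => b n.+1 y) = fun n => \sum_z Q y z * b n z); last first.
  apply/funext => n; rewrite /b; under eq_bigr do rewrite lawS_first.
  by rewrite exchange_big /=; apply: eq_bigr => z _; rewrite mulr_sumr.
apply: cvg_big => [|z _]; first exact: add_continuous.
by apply: cvgMr; exact: b_cvg.
Qed.

(** Turns transition probabilities into a pathwise statement: almost surely no forbidden transition
    is ever made, so a path that reaches an absorbing state stays there. *)
Lemma ae_follow_edges x :
  {ae P x, forall w, forall n, Q (X n w) (X n.+1 w) != 0}.
Proof.
apply: ae_foralln => n.
have H (yz : E * E) : {ae P x, forall w, Q yz.1 yz.2 = 0 ->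
    ~ (X n w = yz.1 /\ X n.+1 w = yz.2)}.
  have [q0|q0] := eqVneq (Q yz.1 yz.2) 0; last by apply: aeW => w q1; rewrite q1 eqxx in q0.
  exists (X n @^-1` [set yz.1] `&` X n.+1 @^-1` [set yz.2]); split.
  - exact: measurableI.
  - rewrite -[LHS]fineK ?fin_num_measure//; last exact: measurableI.
    by rewrite (law_step mX (@X_step x) (Y_iid x) (XY_indep x)) q0 mulr0.
  - by move=> w /= /not_implyP[_ /contrapT].
apply: filterS (filter_forall _ H) => w Hw.
by apply/eqP => /(Hw (X n w, X n.+1 w)); apply.
Qed.

(** A path that is never absorbed lies in [B n] for every [n], so the probability of such paths is
    at most the non-absorbed mass at each time, which tends to zero. *)
Lemma ae_absorbed x : {ae P x, forall w, exists n, Q (X n w) (X n w) = 1}.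
Proof.
pose B n := \bigcup_(y in [set y | Q y y != 1]) (X n @^-1` [set y]).
have mB n : measurable (B n) by apply: fin_bigcup_measurable.
have PB n : fine (P x (B n)) = \sum_(y | Q y y != 1) law_from x n y.
  rewrite (fine_prob_partition (P x) (mX n))// [RHS]big_mkcond; apply: eq_bigr => y _.
  case: ifPn => yy.
    rewrite /law; congr (fine (P x _)); apply/seteqP; split => w /=; first by case.
    by move=> Xw; split => //; exists y.
  rewrite (_ : _ `&` _ = set0) ?measure0// -subset0 => w [[z /= zz Xz] Xy].
  by move: yy; rewrite -Xy Xz zz.
have mBB : measurable (\bigcap_n B n) by exact: bigcapT_measurable.
exists (\bigcap_n B n); split => //; last first.
  move=> w /= /forallNP nw n _; exists (X n w) => //=; apply/eqP; exact: nw.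
apply/eqP; rewrite eq_le measure_ge0 andbT -[leLHS]fineK ?fin_num_measure// lee_fin.
have := transient_cvg0 x; move/cvg_lim => <- //.
apply: limr_ge; first exact: cvgP (transient_cvg0 x).
apply: nearW => n; rewrite -PB fine_le ?fin_num_measure//.
by apply: le_measure; rewrite ?inE// => w /(_ n I).
Qed.

Lemma ae_cvg_chain x (u : E -> R) :
  {ae P x, forall w, cvgn (fun n => u (X n w))}.
Proof.
apply: filterS2 (ae_follow_edges x) (ae_absorbed x) => w edge [n nn].
apply: (cvgP (u (X n w))); apply: cvg_near_cst; exists n => // m /= nm.
congr u; elim: m nm => [|m IHm]; first by rewrite leqn0 => /eqP ->.
rewrite leq_eqVlt => /predU1P[<-//|/IHm Xm].
apply/eqP; apply: contraTT (edge m) => Xneq; rewrite negbK.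
by rewrite Xm absorbing_neq.
Qed.

Lemma stopped_value_step (p u : E -> R) x : stopping_strategy p ->
  stopped_value P X (fun n => Y n) u p x =
  p x * u x + (1 - p x) * \sum_y Q x y * stopped_value P X (fun n => Y n) u p y.
Proof.
move=> p01.
have V_cvg y : iterate_value Q p u n y @[n --> \oo] -->
    stopped_value P X (fun n => Y n) u p y.
  apply: (stopped_value_cvg mX _ (@X_step y) (Y_iid y) (XY_indep y) p01) => //.
  exact: ae_cvg_chain.
have := V_cvg x; rewrite -cvg_shiftS /= => /cvg_lim <- //.
apply: cvg_lim => //; apply: cvgD; first exact: cvg_cst.
apply: cvgMr; apply: cvg_big => [|y _]; first exact: add_continuous.
exact: cvgMr.
Qed.

(** Not a consequence of the one-step equation: if [p a = 0] that equation is a tautology at an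
    absorbing [a]. The value comes from the iterates, all equal to [u a], that is, from the
    convention for infinite stopping times. *)
Lemma stopped_value_absorbing (p u : E -> R) a : stopping_strategy p ->
  absorbing_state Q a -> stopped_value P X (fun n => Y n) u p a = u a.
Proof.
move=> p01 aa.
have V_cvg : iterate_value Q p u n a @[n --> \oo] -->
    stopped_value P X (fun n => Y n) u p a.
  apply: (stopped_value_cvg mX _ (@X_step a) (Y_iid a) (XY_indep a) p01) => //.
  exact: ae_cvg_chain.
have itE n : iterate_value Q p u n a = u a.
  by elim: n => [//|n /= IHn]; rewrite absorbing_sum// IHn; ring.
rewrite -(cvg_lim (@Rhausdorff R) V_cvg).
rewrite (_ : (fun n => _) = fun=> u a); first exact: lim_cst.
exact/funext.
Qed.

Lemma expect_next (v : E -> R) x :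
  expect (P x) (fun w => v (X 1%N w)) = \sum_y Q x y * v y.
Proof.
rewrite -[LHS]/(expect (P x) (v \o X 1%N)) (expect_finite _ _ (mX 1)).
by apply: eq_bigr => y _; rewrite -[fine _]/(law_from x 1 y) law1 mulrC.
Qed.

End absorbing.

(** * Strict convexity and purification of the equilibrium *)

Lemma strictly_convex_interior_max (R : realType) (g : R -> R)
    (p f0 f1 h0 h1 : R) : strictly_convex g -> 0 < p < 1 ->
  (forall q, 0 <= q <= 1 ->
     q * f0 + (1 - q) * f1 + g (q * h0 + (1 - q) * h1)
     <= p * f0 + (1 - p) * f1 + g (p * h0 + (1 - p) * h1)) ->
  f0 = f1 /\ h0 = h1.
Proof.
move=> g_convex p_in opt; have /andP[p0 p1] := p_in.
(* Only the endpoints are tested. If [h0] and [h1] differ, the average of the endpoint payoffs with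
   weights [p] and [1 - p] strictly exceeds the payoff at [p], yet neither endpoint does. If they
   agree, the payoff is affine in [q] with an interior maximum, so its slope [f0 - f1] is zero. *)
have := opt 0; rewrite lexx ler01 !mul0r subr0 !mul1r !add0r => /(_ isT) at0.
have := opt 1; rewrite lexx ler01 subrr !mul0r !mul1r !addr0 => /(_ isT) at1.
have [hh|hh] := eqVneq h0 h1; last first.
  by have := g_convex h0 h1 p hh p_in; nra.
split=> //; move: at0 at1; rewrite -hh.
have -> : p * h0 + (1 - p) * h0 = h0 by ring.
nra.
Qed.

Theorem theorem3p7 (R : realType) (d : measure_display)
    (T : measurableType d) (E : finType) (P : E -> probability T R)
    (X : nat -> T -> E) (Q : E -> E -> R)
    (Y : nat -> {mfun T >-> measurableTypeR R})
    (f h : E -> R) (g : R -> R) (phat : E -> R)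
    (X_markov : markov_chain P X Q)
    (X_absorbing : absorbing_chain P X Q)
    (Y_iid : forall x, iid_uniform01 (P x) Y)
    (XY_indep : forall x, independent_processes (P x) X Y)
    (g_continuous : continuous g)
    (g_strictly_convex : strictly_convex g)
    (phat_equilibrium : equilibrium P X Y f h g phat) :
  (exists p : E -> R,
      pure_equilibrium P X Y f h g p /\
      equivalent_equilibria P X Y f h g p phat) /\
  pure_equilibrium P X Y f h g (purify phat) /\
  equivalent_equilibria P X Y f h g (purify phat) phat.
Proof.
have [phat01 opt] := phat_equilibrium.
have step := stopped_value_step X_markov X_absorbing Y_iid XY_indep.
have next := expect_next X_markov Y_iid XY_indep.
have purify_pure : pure_strategy (purify phat).
  move=> x; rewrite /purify; case: ifPn => [_|]; first by right.
  have /andP[] := phat01 x; rewrite !le_eqVlt => /predU1P[<-|p0]; first by left.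
  by move=> /predU1P[->|p1]; [right|rewrite p0 p1].
have purify01 : stopping_strategy (purify phat).
  by move=> x; case: (purify_pure x) => ->; rewrite lexx ler01.
have indifferent x : 0 < phat x < 1 ->
    f x = stopped_value P X (fun n => Y n) f phat x /\
    h x = stopped_value P X (fun n => Y n) h phat x.
  (* By the one-step equation the equilibrium payoff at [x] is the deviation payoff at [q = phat x],
     an interior maximum. Stopping and continuing then have equal values, and so does their
     mixture. *)
  move=> px; rewrite !step//.
  have [q01|] := @strictly_convex_interior_max _ g (phat x) (f x)
    (\sum_y Q x y * stopped_value P X (fun n => Y n) f phat y) (h x)
    (\sum_y Q x y * stopped_value P X (fun n => Y n) h phat y) g_strictly_convex px.
    move=> q01'; have := opt _ x q01'; rewrite !next /payoff !step//.
  by move=> <- <-; split; ring.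
have same_value (u : E -> R) :
    (forall x, 0 < phat x < 1 -> u x = stopped_value P X (fun n => Y n) u phat x) ->
    stopped_value P X (fun n => Y n) u (purify phat) =
    stopped_value P X (fun n => Y n) u phat.
  (* The maximum principle is applied to the difference of the two value functions. It vanishes at
     absorbing states, where [phat] randomizes (the purified strategy stops, worth [u x], which is
     also the old value) and where both stop; where both continue it is harmonic. *)
  move=> u_eq; apply/funext => x; apply/subr0_eq; move: x.
  apply: (harmonic_eq0 X_markov X_absorbing Y_iid XY_indep) => [a aa|x].
    by rewrite !(stopped_value_absorbing X_markov X_absorbing Y_iid XY_indep)// subrr.
  case: (boolP (0 < phat x < 1)) => [px|npx].
    by left; rewrite step// {1 2}/purify px -u_eq//; ring.
  have pp : purify phat x = phat x by rewrite /purify (negbTE npx).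
  case: (purify_pure x) => p_x; [right|left]; rewrite !step// -pp p_x; last by ring.
  by rewrite !mul0r !add0r subr0 !mul1r -sumrB; apply: eq_bigr => y _; rewrite mulrBr.
have fE := same_value f (fun x px => (indifferent x px).1).
have hE := same_value h (fun x px => (indifferent x px).2).
have eq_payoff x : payoff P X Y f h g (purify phat) x = payoff P X Y f h g phat x.
  by rewrite /payoff fE hE.
have eq_purify : equilibrium P X Y f h g (purify phat).
  (* The inequality involves the strategy only through its two value functions, and these are
     unchanged. *)
  by split=> // q x q01; rewrite eq_payoff fE hE; exact: opt.
by split; [exists (purify phat)|].
Qed.
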